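(* Let $\mathbf{Q}=(Q_1,\dots,Q_k)$ be a straight fermionic multiline queue on $n$ sites. Then the fermionic pairing procedure coincides with the Ferrari–Martin algorithm on $\mathbf{Q}$: both assign the same labels to the particles of $\mathbf{Q}$ (the same label at every site of every row $j$, the labelling of row $j$ in the pairing procedure being $Q_j^{(j)}(\cdots Q_k^{(k)}(\mathbf{w}_0)\cdots)$); in particular $\Phi(\mathbf{Q})=\Phi_{\mathrm{FM}}(\mathbf{Q})$.
   Context: Fix $n\ge1$, $[n]=\{1,\dots,n\}$; sites are considered cyclically (in $\mathbb{Z}/n\mathbb{Z}$). A fermionic multiline queue of type $(\alpha,n)$, $\alpha=(\alpha_1,\dots,\alpha_k)$ a sequence of nonnegative integers, is a tuple $\mathbf{Q}=(Q_1,\dots,Q_k)$ with $Q_j\subseteq[n]$, $|Q_j|=\alpha_j$ (row 1 is the bottom row; elements of $Q_j$ are the particles of row $j$). It is straight if $\alpha$ is a partition ($\alpha_1\ge\cdots\ge\alpha_k$). Let $\mathcal{W}$ be the set of words $(a_1,\dots,a_n)$ of nonnegative integers; for $u\in\mathcal{W}$, $u_+$ is the multiset of nonzero entries. $\iota(Q)\in\{0,1\}^n$ is the indicator vector of $Q\subseteq[n]$. Pairing. For $A,B\subseteq[n]$ ($A$ the lower row, $B$ the upper row), $\mathrm{cpair_f}(A,B)$ (''cylindrically pairing weakly to the right from $B$ to $A$'') is: for $j=1,\dots,n$ in order, write ''('' if $j\in B$ and then '')'' if $j\in A$; view the bracket word on a circle and recursively match each ''('' with a '')'' following it cyclically when there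 are no unmatched brackets between them. An element is paired (unpaired) if its bracket is matched (unmatched). Ferrari–Martin algorithm on a straight $\mathbf{Q}=(Q_1,\dots,Q_k)$: for $r=k,k-1,\dots,1$, label all unlabelled particles in row $r$ with $r$; then (if $r>1$), for $\ell=k,k-1,\dots,r$, cylindrically pair all particles of row $r$ with label $\ell$ weakly to the right to the not-yet-paired particles of row $r-1$, and give the newly paired particles of row $r-1$ the label $\ell$. $\Phi_{\mathrm{FM}}(\mathbf{Q})\in\mathcal{W}$ is the word whose $j$-th letter is the label of the particle at site $j$ of row 1, or $0$ if that site is empty. (In the same way the labelling of any row is viewed as a word, with $0$ at empty sites.) Operators $Q^{(\ell)}$. For $Q\subseteq[n]$, $\ell\ge1$ and $\mathbf{u}=(u_1,\dots,u_n)\in\mathcal{W}$ with $\ell<\min(\mathbf{u}_+)$, define $Q^{(\ell)}(\mathbf{u})=(y_1,\dots,y_n)$ as follows. Initialize all $y_j=0$. Let $a=\min(\mathbf{u}_+)$, $K=\max(\mathbf{u}_+)$, $u^{(r)}=\{j:u_j\ge r\}$. Pairing phase: let $s$ be the maximal $r\in\{a,\dots,K\}$ with $|u^{(r)}|\ge|Q|$, if it exists, and $s=a$ otherwise. For $r=K,K-1,\dots,s$: for each $j\in Q$ which is paired in $\mathrm{cpair_f}(Q,u^{(r)})$ for the first time at step $r$, set $y_j=r$. Then for each $j\in Q$ unpaired in $\mathrm{cpair_f}(Q,u^{(s)})$, set $y_j=\ell$. Collapsing phase: for $r=s,s-1,\dots,a$: for each $j\in u^{(r)}$ newly unpaired (unpaired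 in $\mathrm{cpair_f}(Q,u^{(r)})$ and not unpaired in $\mathrm{cpair_f}(Q,u^{(r+1)})$), set $y_j=r-1$. For the zero word $\mathbf{w}_0=(0,\dots,0)$, $Q^{(\ell)}(\mathbf{w}_0)=\ell\cdot\iota(Q)$. Fermionic pairing procedure / projection: $\Phi(\mathbf{Q})=Q_1^{(1)}\bigl(Q_2^{(2)}(\cdots Q_k^{(k)}(\mathbf{w}_0)\cdots)\bigr)$. *)

(* Defs.v *)
From mathcomp Require Import all_boot.

Set Implicit Arguments.
Unset Strict Implicit.
Unset Printing Implicit Defensive.

(* Site j of [n] = {1, ..., n} is the ordinal j - 1 : 'I_n.                   *)

Section CyclicBrackets.

Variable T : eqType.

(* (true, j) is the bracket "(" written at site j, (false, j) the bracket ")". *)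
Definition bracket : Type := (bool * T)%type.

Implicit Type w : seq bracket.

(* A duplicate-free sequence w is read on a circle, next w x being the        *)
(* bracket that follows x cyclically.                                         *)
Definition matchable w : seq bracket :=
  [seq x <- w | x.1 && ~~ (next w x).1].

(* The unmatched brackets are kept and matched ones deleted, so that two      *)
(* brackets are neighbours in w iff no unmatched bracket lies between them.   *)
(* Which matchable pair is removed first does not affect the end result.      *)
Definition match1 w : seq bracket :=
  if matchable w is x :: _ then [seq y <- w | (y != x) && (y != next w x)]
  else w.

Definition unmatched w : seq bracket := iter (size w) match1 w.

End CyclicBrackets.

Section MultilineQueues.

Variable n : nat.

Definition word : Type := {ffun 'I_n -> nat}.

Implicit Types (A B Q S : {set 'I_n}) (u y : word).

Definition w0 : word := [ffun=> 0].

(* Brackets for cpair_f(A, B), with A the lower row and B the upper row.      *)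
Definition bracket_word A B : seq (bracket 'I_n) :=
  flatten [seq (if j \in B then [:: (true, j)] else [::]) ++
               (if j \in A then [:: (false, j)] else [::]) | j <- enum 'I_n].

Definition cpair_f A B : seq (bracket 'I_n) := unmatched (bracket_word A B).

Definition paired_low A B : {set 'I_n} :=
  [set j in A | (false, j) \notin cpair_f A B].
Definition unpaired_low A B : {set 'I_n} :=
  [set j in A | (false, j) \in cpair_f A B].
Definition unpaired_up A B : {set 'I_n} :=
  [set j in B | (true, j) \in cpair_f A B].

Definition assign y S (v : nat) : word :=
  [ffun j => if j \in S then v else y j].

(* The integers a, ..., b in decreasing order (empty if b < a).               *)
Definition downto (b a : nat) : seq nat := rev (index_iota a b.+1).

Definition max_word u : nat := \max_j u j.

(* The least nonzero letter, for u != w0.                                     *)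
Definition min_word u : nat := \big[minn/max_word u]_(j | u j != 0) u j.

Definition level u (r : nat) : {set 'I_n} := [set j | r <= u j].

(* The empty maximum is 0, so this is min_word u when no r qualifies.         *)
Definition switch_level Q u : nat :=
  maxn (min_word u)
    (\max_(min_word u <= r < (max_word u).+1 | #|Q| <= #|level u r|) r).

Definition newly_paired Q u (r : nat) : {set 'I_n} :=
  [set j in paired_low Q (level u r) |
    all (fun r' => j \notin paired_low Q (level u r'))
        (index_iota r.+1 (max_word u).+1)].

Definition newly_unpaired Q u (r : nat) : {set 'I_n} :=
  unpaired_up Q (level u r) :\: unpaired_up Q (level u r.+1).

Definition pairing_phase (l : nat) Q u : word :=
  let s := switch_level Q u in
  let y := foldl (fun y r => assign y (newly_paired Q u r) r) w0
             (downto (max_word u) s) in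
  assign y (unpaired_low Q (level u s)) l.

Definition collapsing_phase Q u y : word :=
  foldl (fun y r => assign y (newly_unpaired Q u r) r.-1) y
    (downto (switch_level Q u) (min_word u)).

(* Q^(l)(u), meaningful when u = w0 or l < min_word u.                        *)
Definition row_op (l : nat) Q u : word :=
  if u == w0 then assign w0 Q l
  else collapsing_phase Q u (pairing_phase l Q u).

(* Labels of row r (with particles A), given the labels u of row r + 1 of a   *)
(* queue with k rows. Labels are positive, so y j = 0 means that the particle *)
(* at j has not been paired yet. For the top row, r = k, no pairing occurs.   *)
Definition fm_step (k r : nat) A u : word :=
  let y := foldl
    (fun y l => assign y (paired_low [set j in A | y j == 0]
                                     [set j | u j == l]) l)
    w0 (downto k r.+1) in
  assign y [set j in A | y j == 0] r.

Section Queue.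

Variable k : nat.

Implicit Types (Qs : k.-tuple {set 'I_n}) (alpha : k.-tuple nat).

Definition is_fmlq alpha Qs : Prop :=
  forall i : 'I_k, #|tnth Qs i| = tnth alpha i.

Definition is_partition alpha : bool := sorted geq alpha.

(* Rows are numbered 1, ..., k from bottom to top.                            *)
Definition mlq_row Qs (r : nat) : {set 'I_n} := nth set0 Qs r.-1.

(* Q_j^(j) (Q_(j+1)^(j+1) ( ... Q_k^(k) (w0) ... )).                          *)
Definition pairing_labels Qs (j : nat) : word :=
  foldr (fun r u => row_op r (mlq_row Qs r) u) w0 (index_iota j k.+1).

Definition fm_labels Qs (j : nat) : word :=
  foldr (fun r u => fm_step k r (mlq_row Qs r) u) w0 (index_iota j k.+1).

Definition Phi Qs : word := pairing_labels Qs 1.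

Definition Phi_FM Qs : word := fm_labels Qs 1.

End Queue.

End MultilineQueues.

(* Main.v *)
Require Import Defs.
From mathcomp Require Import all_boot.
From mathcomp Require Import zify.

Set Implicit Arguments.
Unset Strict Implicit.
Unset Printing Implicit Defensive.

(** Read the elements of the upper row B as cars and those of the lower row A
    as parking spots. Cylindrical pairing is parking: a car b drives to the
    right from its own site and takes the first free spot. Matching innermost
    brackets first does not follow this order literally, but it produces a
    bijection f from B to a set P of spots such that every spot in the arc from
    b to f b ends up occupied; [parks A B P] records exactly this. Two facts
    then do the work.

    - The occupied set P depends on A and B only, not on f ([parks_unique]). If
      j is occupied for f but not for g, look at the arc I that ends at j and
      starts just after the last spot left free by f. No car enters I from
      outside under f, so I holds at least as many cars as spots; no car
      crosses j under g, so the cars of I fit into the spots of I other than j.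
      This is a contradiction.

    - Parking is additive ([parks_comp]): parking B in A and then B' in the
      spots left free parks B :|: B' in A.

    Hence, when #|B :|: B'| <= #|A|, the set paired with B :|: B' is the set
    paired with B together with what B' pairs among the rest
    ([paired_lowU]).

    Now let u be the labelling of row r + 1, A the set of particles of row r,
    and P_m the set of particles of A paired with [level u m]. Ferrari-Martin
    pairs the particles of label l with A minus P_(l+1), and by additivity it
    hits P_l minus P_(l+1). The pairing phase of row_op gives the label l to
    the particles paired for the first time at step l, which is P_l minus
    P_(l+1) again, because the sets P_m decrease in m. The two rules differ
    only through the switch level and the collapsing phase. Both are trivial
    for a straight queue: A has at least as many particles as u, so the switch
    level is the smallest letter of u ([switch_levelE]), and no particle of the
    upper row stays unpaired ([unpaired_up0]). Induction on the rows from the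
    top down concludes. *)

(** * Minima of natural numbers *)

Section BigMin.
Variables (I : finType) (P : pred I) (F : I -> nat) (m : nat).

Lemma bigminn_le i : P i -> \big[minn/m]_(j | P j) F j <= F i.
Proof.
move=> Pi; have: i \in index_enum I by rewrite mem_index_enum.
elim: (index_enum _) => // j s IHs; rewrite inE big_cons.
case/predU1P=> [<-|/IHs le_s]; first by rewrite Pi geq_minl.
by case: ifP => // _; rewrite geq_min le_s orbT.
Qed.

Lemma bigminn_attained :
  \big[minn/m]_(j | P j) F j = m \/
  exists2 i, P i & \big[minn/m]_(j | P j) F j = F i.
Proof.
apply: (big_ind (fun v => v = m \/ exists2 i, P i & v = F i)).
- by left.
- by move=> v v' Hv Hv'; rewrite /minn; case: ifP.
- by move=> i Pi; right; exists i.
Qed.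

End BigMin.

(** * Cyclic distance and parking *)

(** The number of steps to the right from i to j on a circle with N sites. *)
Definition cdist N i j := if i <= j then j - i else N + j - i.

Lemma cdist_addl N i x j : i < N -> x < N -> j < N ->
  cdist N i x <= cdist N i j -> cdist N i x + cdist N x j = cdist N i j.
Proof. rewrite /cdist; case: (leqP i x); case: (leqP i j); case: (leqP x j); lia. Qed.

Lemma cdist_addr N i x j : i < N -> x < N -> j < N ->
  cdist N x j <= cdist N i j -> cdist N i x + cdist N x j = cdist N i j.
Proof. rewrite /cdist; case: (leqP i x); case: (leqP i j); case: (leqP x j); lia. Qed.

Lemma cdist_lt N i j : i < N -> j < N -> cdist N i j < N.
Proof. rewrite /cdist; case: (leqP i j); lia. Qed.

Lemma cdistxx N i : cdist N i i = 0.
Proof. by rewrite /cdist leqnn subnn. Qed.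

Section Parking.
Variable n : nat.
Implicit Types (A B P : {set 'I_n}).

(** The arc from b to f b consists of the sites at distance at most
    cdist n b (f b) from b. Asking that the spots of this arc be occupied at
    the end, rather than when b parks, makes the notion independent of the
    order in which the cars arrive. *)
Definition parks A B P :=
  exists f : 'I_n -> 'I_n,
  [/\ {in B &, injective f}, f @: B = P, P \subset A &
      forall b a, b \in B -> a \in A -> cdist n b a <= cdist n b (f b) -> a \in P].

Lemma card_parks A B P : parks A B P -> #|P| = #|B|.
Proof. by case=> f [injf <- _ _]; rewrite card_in_imset. Qed.

(** Cars and spots are counted on an arc that ends at a spot j of P outside P'
    and that no car enters from outside under the first parking. *)
Lemma parks_sub A B P P' : parks A B P -> parks A B P' -> P \subset P'.
Proof.
case=> f [injf imf sPA parkf] [g [injg img sP'A parkg]].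
apply/subsetP=> j jP; apply/negPn/negP=> jP'.
have jA : j \in A by apply: (subsetP sPA).
(* D is the distance back to the last spot of A outside P, or n, which *)
(* makes the arc I below the whole circle, if P fills A. *)
pose D := \big[minn/n]_(x in A :\: P) cdist n x j.
have [Dlt Dle] : (forall x, x \in A -> cdist n x j < D -> x \in P) /\
   (D = n \/ exists2 x, x \in A :\: P & D = cdist n x j).
  split=> [x xA|]; last exact: bigminn_attained.
  apply: contraTT => xP; rewrite -leqNgt.
  by apply: (bigminn_le (fun y : 'I_n => cdist n y j) n); rewrite inE xP.
pose I := [set x : 'I_n | cdist n x j < D].
have D_gt0 : 0 < D.
  case: Dle => [->|[x /setDP[xA xP] ->]]; first exact: leq_ltn_trans (ltn_ord j).
  have : x != j by apply: contraNneq xP => ->.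
  rewrite /cdist -val_eqE /=; have := ltn_ord x; have := ltn_ord j.
  by case: ifP; lia.
have jI : j \in I by rewrite inE cdistxx.
(* A car parked by f in I started in I: it would cross a spot outside P. *)
have le1 : #|A :&: I| <= #|B :&: I|.
  have sub : A :&: I \subset f @: (B :&: I).
    apply/subsetP=> x /setIP[xA]; rewrite inE => xI.
    have xP := Dlt x xA xI; move: xP; rewrite -imf => /imsetP[c cB def_x].
    rewrite def_x; apply: imset_f; rewrite inE cB inE ltnNge; apply/negP=> Dc.
    case: Dle => [Dn|[y /setDP[yA /negP]]].
      by move: Dc; rewrite Dn leqNgt cdist_lt.
    move=> + Dy; apply; apply: (parkf c y cB yA).
    have := @cdist_addr n c y j (ltn_ord _) (ltn_ord _) (ltn_ord _).
    have := @cdist_addr n c x j (ltn_ord _) (ltn_ord _) (ltn_ord _).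
    rewrite -def_x; move: Dc xI; rewrite Dy; lia.
  by apply: leq_trans (subset_leq_card sub) (leq_imset_card _ _).
(* A car of I does not cross j under g, so it stays in I and misses j. *)
have le2 : #|B :&: I| <= #|(A :&: I) :\ j|.
  rewrite -(card_in_imset (D := B :&: I) (f := g)); last first.
    by move=> x y /setIP[xB _] /setIP[yB _]; apply: injg.
  apply/subset_leq_card/subsetP=> x /imsetP[c /setIP[cB]]; rewrite inE => cI ->.
  have gP' : g c \in P' by rewrite -img imset_f.
  rewrite !inE (subsetP sP'A _ gP') /= andbC; apply/andP; split; last first.
    by apply: contraNneq jP' => <-.
  have: ~~ (cdist n c j <= cdist n c (g c)).
    by apply: contra jP' => /(parkg c j cB jA).
  have := @cdist_addl n c (g c) j (ltn_ord _) (ltn_ord _) (ltn_ord _).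
  lia.
have := leq_trans le1 le2.
by rewrite (cardsD1 j (A :&: I)) inE jA jI ltnn.
Qed.

Lemma parks_unique A B P P' : parks A B P -> parks A B P' -> P = P'.
Proof. by move=> pP pP'; apply/eqP; rewrite eqEsubset !(parks_sub (A := A) (B := B)). Qed.

(** The union of the two parking functions works: spots crossed by a car of B'
    are either in P or among those that B' had to choose from. *)
Lemma parks_comp A B B' P P' : [disjoint B & B'] ->
  parks A B P -> parks (A :\: P) B' P' -> parks A (B :|: B') (P :|: P').
Proof.
move=> dBB' [f [injf imf sPA parkf]] [g [injg img sP'A parkg]].
have B'nB b : b \in B' -> (b \in B) = false by move=> bB'; apply: (disjointFl dBB').
have fP b : b \in B -> f b \in P by move=> bB; rewrite -imf imset_f.
have gP b : b \in B' -> (g b \in P') * (g b \notin P).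
  move=> bB; have gb : g b \in P' by rewrite -img imset_f.
  by have := subsetP sP'A _ gb; rewrite inE => /andP[].
exists (fun b => if b \in B then f b else g b); split.
- move=> b c /setUP[bB|bB] /setUP[cB|cB]; rewrite ?bB ?cB ?B'nB //.
  + exact: injf.
  + by move=> E; have := fP _ bB; rewrite E (negPf (gP _ cB).2).
  + by move=> E; have := fP _ cB; rewrite -E (negPf (gP _ bB).2).
  + exact: injg.
- rewrite imsetU -imf -img; congr (_ :|: _).
    by apply: eq_in_imset => b ->.
  by apply: eq_in_imset => b /B'nB->.
- by rewrite subUset sPA (subset_trans sP'A) ?subsetDl.
- move=> b a /setUP[bB|bB] aA; rewrite ?bB ?B'nB //= inE.
    by move/(parkf _ _ bB aA) => ->.
  case: (boolP (a \in P)) => //= aP; apply: parkg => //; by rewrite inE aP.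
Qed.

Lemma parks0 A : parks A set0 set0.
Proof. by exists id; split=> [b c|||b a]; rewrite ?inE ?imset0 ?sub0set. Qed.

(** One matching step: the closest spot is the only one on the arc. *)
Lemma parks1 A (b a : 'I_n) : a \in A ->
  (forall a', a' \in A -> cdist n b a' <= cdist n b a -> a' = a) ->
  parks A [set b] [set a].
Proof.
move=> aA near; exists (fun=> a); split=> [x y /set1P-> /set1P-> //|||c x].
- by rewrite imset_set1.
- by rewrite sub1set.
- by move/set1P=> -> /near h /h ->; rewrite inE.
Qed.

End Parking.

(** * Cyclic bracket matching as parking *)

(** In a word read by increasing positions on a circle of length N, the
    successor of x is the letter met first when moving right from x. *)
Lemma next_cdist (T : eqType) (p : T -> nat) N (w : seq T) x y :
    sorted (relpre p ltn) w -> {in w, forall z, p z < N} ->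
    x \in w -> y \in w -> y != x ->
  cdist N (p x) (p (next w x)) <= cdist N (p x) (p y).
Proof.
have tr : transitive (relpre p ltn) by move=> a b c; apply: ltn_trans.
move=> sw wN xw; case/splitPr: xw sw wN => w1 w2 sw wN.
have uw : uniq (w1 ++ x :: w2).
  by apply: sorted_uniq sw => // a; rewrite /= ltnn.
have -> : next (w1 ++ x :: w2) x = head (head x w1) w2.
  rewrite next_nth mem_cat mem_head orbT index_cat /= eqxx addn0.
  have /negPf-> : x \notin w1.
    by move: uw; rewrite cat_uniq /= negb_or => /and3P[_ /andP[]].
  case: w1 {sw wN uw} => [|z w1] /=; first by rewrite nth0.
  rewrite nth_cat ltnNge leqnSn /= subSnn.
  by case: w2.
move: sw; rewrite sorted_pairwise // pairwise_cat /= => /and4P[].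
rewrite /allrel => /allP l1 pw1 /allP l2 pw2.
have xN : p x < N by apply: wN; rewrite mem_cat mem_head orbT.
rewrite mem_cat inE orbCA => + /negPf yx; rewrite yx /= => yw.
have yN : p y < N by apply: wN; rewrite mem_cat inE yx.
case/orP: yw => yw.
  have /andP[/= yx1 /allP y2] := l1 y yw.
  case: w2 {uw l1} wN l2 pw2 y2 => [|z w2] wN l2 pw2 y2 /=.
    case: w1 wN yw pw1 => //= z w1 wN; rewrite inE.
    case/predU1P=> [-> _ //|yw /andP[/allP/(_ _ yw) /= zy _]].
    rewrite /cdist; case: ifP; case: ifP; lia.
  have /= xz := l2 z (mem_head _ _).
  have zN : p z < N by apply: wN; rewrite mem_cat !inE eqxx !orbT.
  rewrite /cdist; case: ifP; case: ifP; lia.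
case: w2 {uw l1} wN yw l2 pw2 => //= z w2 wN yw l2 /andP[/allP zw2 _].
have /= xz := l2 z (mem_head _ _); have /= xy := l2 y yw.
have zy : p z <= p y.
  by move: yw; rewrite inE => /predU1P[-> //|/zw2 /= /ltnW].
by rewrite /cdist; case: ifP; case: ifP; lia.
Qed.

(** A circle cannot be left by moving right, so a property that passes to the
    successor holds everywhere as soon as it holds once. *)
Lemma next_closed (T : eqType) (a : pred T) (w : seq T) x :
  uniq w -> x \in w -> a x -> {in w, forall z, a z -> a (next w z)} -> all a w.
Proof.
move=> uw xw ax step; have [i w' def_w] := rot_to xw.
rewrite -(eq_all_r (mem_rot i w)); have: cycle (fun y z => a y ==> a z) (rot i w).
  rewrite rot_cycle; move: step (cycle_next uw); move: (next w) => nx step.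
  case: w {uw xw def_w} step => //= z w step.
  have {}step : all (fun y => a y ==> a (nx y)) (z :: w).
    by apply/allP=> y yw; apply/implyP/step.
  have {}step : all (fun y => a y ==> a (nx y)) (z :: rcons w z).
    by case/andP: (step) => sz _; rewrite -rcons_cons all_rcons step andbT.
  move: (rcons w z) step => s; elim: s z => //= y s IHs v.
  by move=> /andP[nv sa] /andP[/eqP nx_v sn]; move: nv; rewrite nx_v IHs // => ->.
rewrite def_w /= rcons_path => /andP[pw _]; rewrite ax.
have tr : transitive (fun y z => a y ==> a z).
  by move=> y z t; case: (a z); case: (a y); case: (a t).
by have := order_path_min tr pw; rewrite ax.
Qed.

Section Matching.
Variable T : eqType.
Implicit Types w : seq (bracket T).

Lemma match1_id w : matchable w = [::] -> match1 w = w.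
Proof. by rewrite /match1 => ->. Qed.

(** Each effective step shortens the word, so size w steps suffice. *)
Lemma matchable_unmatched w : matchable (unmatched w) = [::].
Proof.
suff main m v : size v <= m -> matchable (iter m (@match1 T) v) = [::].
  exact: main.
elim: m v => [|m IHm] {}w; first by case: w.
rewrite iterSr => le_w; case def_m: (matchable w) => [|x s].
  rewrite match1_id //; elim: m {IHm le_w} => [|m IHm] //=.
  by rewrite match1_id.
apply: IHm; rewrite /match1 def_m -ltnS; apply: leq_trans le_w.
have xw : x \in w.
  have: x \in matchable w by rewrite def_m mem_head.
  by rewrite mem_filter => /andP[].
by rewrite size_filter -(count_predC (fun y => (y != x) && (y != next w x)) w)
   -[X in X < _]addn0 ltn_add2l -has_count; apply/hasP; exists x; rewrite //= eqxx.
Qed.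

End Matching.

Section CylindricPairing.
Variable n : nat.
Implicit Types (A B P : {set 'I_n}) (w : seq (bracket 'I_n)).

(** Doubling the number of sites leaves room for the bracket of B before the
    bracket of A at the same site. *)
Definition bracket_pos (x : bracket 'I_n) : nat := x.2.*2 + ~~ x.1.

Lemma mem_bracket_word A B c j :
  ((c, j) \in bracket_word A B) = (j \in if c then B else A).
Proof.
apply/flattenP/idP => [[s /mapP[i _ ->]]|jAB].
  by rewrite mem_cat /bracket; case: ifP; case: ifP => iA iB;
     rewrite ?mem_seq1 ?in_nil ?xpair_eqE; case: c => //=; rewrite ?orbF => // /eqP->.
eexists; first by apply: (map_f _ (x := j)); rewrite mem_enum.
by rewrite mem_cat /bracket; case: c jAB => ->; rewrite mem_seq1 eqxx ?orbT.
Qed.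

Lemma bracket_word_sorted A B : sorted (relpre bracket_pos ltn) (bracket_word A B).
Proof.
have tr : transitive (relpre bracket_pos ltn) by move=> a b c; apply: ltn_trans.
rewrite sorted_pairwise // /bracket_word.
have: sorted (relpre val ltn) (enum 'I_n).
  by rewrite -sorted_map val_enum_ord iota_ltn_sorted.
rewrite sorted_pairwise; last by move=> a b c; apply: ltn_trans.
have site_of (x : bracket 'I_n) (i : 'I_n) :
    x \in (if i \in B then [:: (true, i)] else [::]) ++
          (if i \in A then [:: (false, i)] else [::]) -> x.2 = i.
  rewrite mem_cat /bracket; case: ifP => _; case: ifP => _;
  by rewrite ?mem_seq1 ?in_nil ?orbF //=; do ?[case/orP]; move/eqP->.
elim: (enum _) => //= i s IHs /andP[/allP is_ /IHs {}IHs].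
rewrite pairwise_cat IHs andbT; apply/andP; split.
  apply/allrelP=> x y xi /flattenP[t /mapP[j js ->] yj].
  have ij : i < j := is_ j js.
  rewrite /= /bracket_pos (site_of _ _ xi) (site_of _ _ yj).
  by case: (x.1) (y.1) => -[] /=; lia.
by case: ifP; case: ifP; rewrite //= /bracket_pos /=; lia.
Qed.

(** Invariant of the matching: the brackets removed so far form a parking.
    In particular the spots between two matched brackets are all gone, which
    is why neighbours in w may be matched as if nothing lay between them. *)
Definition matching_state A B w :=
  [/\ sorted (relpre bracket_pos ltn) w, {subset w <= bracket_word A B} &
      parks A [set b in B | (true, b) \notin w] [set a in A | (false, a) \notin w]].

Lemma matching_state0 A B : matching_state A B (bracket_word A B).
Proof.
split=> //; first exact: bracket_word_sorted.
have -> : [set b in B | (true, b) \notin bracket_word A B] = set0.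
  by apply/setP=> b; rewrite !inE mem_bracket_word andbN.
have -> : [set a in A | (false, a) \notin bracket_word A B] = set0.
  by apply/setP=> b; rewrite !inE mem_bracket_word andbN.
exact: parks0.
Qed.

(** Additivity of parking, applied to the removed brackets and to one more car
    b0, which takes the first remaining spot a0 to its right. *)
Lemma matching_state_match1 A B w :
  matching_state A B w -> matching_state A B (match1 w).
Proof.
case=> sw subw; rewrite /match1; case def_m: (matchable w) => [|x s] //.
have: x \in matchable w by rewrite def_m mem_head.
rewrite mem_filter => /andP[/andP[] + + xw]; have yw : next w x \in w by rewrite mem_next.
have near y : y \in w -> y != x ->
    cdist n.*2 (bracket_pos x) (bracket_pos (next w x)) <=
    cdist n.*2 (bracket_pos x) (bracket_pos y).
  apply: next_cdist => // -[c j] _; rewrite /bracket_pos /=; have := ltn_ord j; case: c; lia.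
case: (next w x) yw near => -[] a0 //=; case: x xw {def_m} => -[] b0 // xw yw near _ _.
have {}near (a : 'I_n) : (false, a) \in w -> cdist n b0 a <= cdist n b0 a0 -> a = a0.
  move/near => /(_ isT); rewrite /bracket_pos /cdist /= => le1 le2; apply: val_inj => /=.
  move: (ltn_ord a) (ltn_ord a0) (ltn_ord b0) le1 le2.
  by do !case: ifP => ?; lia.
move=> parkw; split.
- by apply: sorted_filter => // a b c; apply: ltn_trans.
- by move=> z; rewrite mem_filter => /andP[_ /subw].
have b0B : b0 \in B by have := subw _ xw; rewrite mem_bracket_word.
have a0A : a0 \in A by have := subw _ yw; rewrite mem_bracket_word.
set R := [set b in B | _] in parkw; set P := [set a in A | _] in parkw.
set R' := [set b in B | _]; set P' := [set a in A | _].
have -> : R' = R :|: [set b0].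
  apply/setP=> b; rewrite !inE mem_filter !xpair_eqE /= andbT.
  by case: eqVneq => [->|_]; rewrite ?b0B ?orbT ?orbF.
have -> : P' = P :|: [set a0].
  apply/setP=> b; rewrite !inE mem_filter !xpair_eqE /=.
  by case: eqVneq => [->|_]; rewrite ?a0A ?orbT ?orbF.
apply: parks_comp => //.
  by rewrite disjoint_sym disjoints1 !inE xw andbF.
apply: parks1 => [|a /setDP[aA]]; rewrite !inE; first by rewrite a0A yw.
by rewrite aA negbK => /near.
Qed.

Lemma cpair_f_state A B : matching_state A B (cpair_f A B).
Proof.
rewrite /cpair_f /unmatched; elim: (size _) => [|m IHm] /=.
  exact: matching_state0.
exact: matching_state_match1.
Qed.

(** When no pair is matchable, an opening bracket forces its successor to be
    opening, hence the whole circle to be opening. Then all of A is matched,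
    by #|A| elements of B, and b would be one more element of B. *)
Lemma cpair_f_closed A B b : #|B| <= #|A| -> (true, b) \notin cpair_f A B.
Proof.
move=> leBA; apply/negP=> bw.
have [sw subw parkw] := cpair_f_state A B.
have uw : uniq (cpair_f A B).
  by apply: sorted_uniq sw => [x y z|x]; [apply: ltn_trans | rewrite /= ltnn].
have opening : all (fun x => x.1) (cpair_f A B).
  apply: (next_closed uw bw) => // x xw x1; apply/negPn/negP=> nx.
  have: x \in matchable (cpair_f A B) by rewrite mem_filter x1 nx.
  by rewrite matchable_unmatched.
have := card_parks parkw.
have -> : [set a in A | (false, a) \notin cpair_f A B] = A.
  apply/setP=> a; rewrite inE andb_idr // => _.
  by apply/negP=> /(allP opening).
move=> cardA; have: #|[set b in B | (true, b) \notin cpair_f A B]| < #|B|.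
  apply: proper_card; apply/properP; split.
    by apply/subsetP=> c; rewrite inE => /andP[].
  exists b; last by rewrite inE bw andbF.
  by have := subw _ bw; rewrite mem_bracket_word.
by rewrite -cardA ltnNge leBA.
Qed.

Lemma unpaired_up0 A B : #|B| <= #|A| -> unpaired_up A B = set0.
Proof.
by move=> leBA; apply/setP=> b; rewrite !inE (negPf (cpair_f_closed b leBA)) andbF.
Qed.

Lemma paired_low_sub A B : paired_low A B \subset A.
Proof. by apply/subsetP=> a; rewrite inE => /andP[]. Qed.

Lemma paired_low_parks A B : #|B| <= #|A| -> parks A B (paired_low A B).
Proof.
move=> leBA; have [_ _] := cpair_f_state A B.
have -> // : [set b in B | (true, b) \notin cpair_f A B] = B.
by apply/setP=> b; rewrite inE cpair_f_closed ?andbT.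
Qed.

(** Additivity of the pairing, read off from uniqueness and additivity of
    parking. *)
Lemma paired_lowU A B B' : [disjoint B & B'] -> #|B :|: B'| <= #|A| ->
  paired_low A (B :|: B') =
  paired_low A B :|: paired_low (A :\: paired_low A B) B'.
Proof.
move=> dBB' leA.
have card_U : #|B :|: B'| = #|B| + #|B'| by apply/eqP; rewrite leq_card_setU.
have leB : #|B| <= #|A| by apply: leq_trans leA; rewrite card_U leq_addr.
have parkB := paired_low_parks leB.
apply: parks_unique (paired_low_parks leA) (parks_comp dBB' parkB _).
apply: paired_low_parks.
by rewrite cardsD (setIidPr (paired_low_sub A B)) (card_parks parkB) leq_subRL // -card_U.
Qed.

Lemma paired_low0 A : paired_low A set0 = set0.
Proof.
by apply: parks_unique (paired_low_parks _) (parks0 A); rewrite cards0.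
Qed.

End CylindricPairing.

Lemma paired_lowS n (A B B' : {set 'I_n}) : B \subset B' -> #|B'| <= #|A| ->
  paired_low A B \subset paired_low A B'.
Proof.
move=> sBB' leA.
have def_B' : B' = B :|: (B' :\: B) by rewrite setDE setUIr setUCr setIT; apply/esym/setUidPr.
rewrite def_B' paired_lowU ?subsetUl -?def_B' //.
by rewrite disjoint_sym disjoints_subset subsetDr.
Qed.

(** * Comparison of the two labellings of a row *)

Lemma mem_downto b a r : (r \in downto b a) = (a <= r <= b).
Proof. by rewrite mem_rev mem_index_iota ltnS. Qed.

Lemma downto_nil b a : b < a -> downto b a = [::].
Proof. by move=> lt_ba; rewrite /downto /index_iota; have /eqP-> : b.+1 - a == 0. Qed.

Lemma downto_rcons b a : a <= b -> downto b a = rcons (downto b a.+1) a.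
Proof. by move=> le_ab; rewrite /downto /index_iota subSn //= rev_cons subSS. Qed.

Lemma downto_cat b c a : a <= c.+1 -> c <= b ->
  downto b a = downto b c.+1 ++ downto c a.
Proof.
move=> le_ac le_cb; rewrite /downto -rev_cat /index_iota; congr rev.
have -> : b.+1 - a = (c.+1 - a) + (b.+1 - c.+1) by lia.
by rewrite iotaD subnKC.
Qed.

Section Rows.
Variable n : nat.
Implicit Types (A S : {set 'I_n}) (u y : word n).

Lemma assign0 y v : assign y set0 v = y.
Proof. by apply/ffunP=> j; rewrite ffunE inE. Qed.

Lemma foldl_assign0 (S : nat -> {set 'I_n}) (s : seq nat) y :
  {in s, forall r, S r = set0} -> foldl (fun y r => assign y (S r) r) y s = y.
Proof.
elim: s y => //= r s IHs y S0; rewrite S0 ?mem_head // assign0 IHs // => x xs.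
by rewrite S0 // inE xs orbT.
Qed.

Lemma eq_foldl_in (T R : eqType) (f g : R -> T -> R) (s : seq T) (y : R) :
  (forall z, {in s, f z =1 g z}) -> foldl f y s = foldl g y s.
Proof.
elim: s y => //= r s IHs y fg; rewrite fg ?mem_head // IHs // => z x xs.
by rewrite fg // inE xs orbT.
Qed.

Lemma levelS u r : level u r = level u r.+1 :|: [set j | u j == r].
Proof. by apply/setP=> j; rewrite !inE leq_eqVlt eq_sym orbC. Qed.

Lemma level_disjoint u r : [disjoint level u r.+1 & [set j | u j == r]].
Proof.
by rewrite -setI_eq0; apply/eqP/setP=> j; rewrite !inE; case: ltngtP.
Qed.

Lemma level_sub u r r' : r <= r' -> level u r' \subset level u r.
Proof. by move=> le_rr'; apply/subsetP=> j; rewrite !inE; apply: leq_trans. Qed.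

Lemma level_gt u k r : (forall j, u j <= k) -> k < r -> level u r = set0.
Proof.
by move=> uk lt_kr; apply/setP=> j; rewrite !inE leqNgt (leq_ltn_trans (uk j)).
Qed.

Lemma level_low u r r' : (forall j, u j != 0 -> r' <= u j) -> 0 < r <= r' ->
  level u r = level u r'.
Proof.
move=> ur' /andP[r0 le_rr']; apply/eqP; rewrite eqEsubset [X in _ && X]level_sub // andbT.
by apply/subsetP=> j; rewrite !inE => /(leq_trans r0); rewrite lt0n => /ur'.
Qed.

(** The particles that first pair at step r; both algorithms give them the
    label r. *)
Definition layer A u r := paired_low A (level u r) :\: paired_low A (level u r.+1).

(** The common form to which the main loops of both algorithms are reduced. *)
Definition layer_word A u k m : word n :=
  foldl (fun y r => assign y (layer A u r) r) (w0 n) (downto k m).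

Section Straight.

Variables (A : {set 'I_n}) (u : word n).
Hypothesis leA : #|level u 1| <= #|A|.

Lemma leA_level r : 0 < r -> #|level u r| <= #|A|.
Proof. by move=> r0; apply: leq_trans leA; apply/subset_leq_card/level_sub. Qed.

Lemma paired_low_levelS r : 0 < r ->
  paired_low A (level u r) = paired_low A (level u r.+1) :|:
     paired_low (A :\: paired_low A (level u r.+1)) [set j | u j == r].
Proof.
move=> r0; rewrite [in LHS]levelS paired_lowU -?levelS ?leA_level //.
exact: level_disjoint.
Qed.

(** What Ferrari-Martin pairs with the label r. *)
Lemma layerE r : 0 < r ->
  paired_low (A :\: paired_low A (level u r.+1)) [set j | u j == r] = layer A u r.
Proof.
move=> r0; rewrite /layer (paired_low_levelS r0) setDUl setDv set0U.
apply/esym/setDidPl; rewrite disjoints_subset; apply: subset_trans (paired_low_sub _ _) _.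
by rewrite setDE subsetIr.
Qed.

(** The second component describes the particles not yet labelled; it is the
    induction hypothesis that turns a Ferrari-Martin step into [layerE], and
    it also gives the particles that receive the default label at the end. *)
Lemma fm_foldE k m : (forall j, u j <= k) -> 0 < m <= k.+1 ->
  foldl (fun y l => assign y (paired_low [set j in A | y j == 0] [set j | u j == l]) l)
    (w0 n) (downto k m) = layer_word A u k m /\
  [set j in A | layer_word A u k m j == 0] = A :\: paired_low A (level u m).
Proof.
move=> uk /andP[m0 le_mk].
have [d def_m] : exists d, m + d = k.+1 by exists (k.+1 - m); rewrite subnKC.
elim: d m def_m m0 {le_mk} => [|d IHd] m def_m m0.
  rewrite addn0 in def_m; rewrite /layer_word def_m downto_nil //; split=> //.
  rewrite (level_gt uk) // paired_low0 setD0.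
  by apply/setP=> j; rewrite !inE !ffunE eqxx andbT.
have [||IH1 IH2] := IHd m.+1; rewrite ?addSnnS //.
have le_mk : m <= k by lia.
rewrite /layer_word downto_rcons // !foldl_rcons IH1 -/(layer_word A u k m.+1) IH2.
rewrite layerE // (paired_low_levelS m0) layerE //; split=> //.
move: (paired_low _ _) (layer _ _ _) IH2 => P L /setP IH2.
apply/setP=> j; move: (IH2 j); rewrite !inE ffunE.
by case: ifP => _; rewrite ?(gtn_eqF m0) ?orbT ?andbF ?orbF.
Qed.

Hypothesis u_neq0 : u != w0 n.

Lemma exists_letter : exists j, u j != 0.
Proof.
apply/existsP; apply: contraR u_neq0; rewrite negb_exists => /forallP u0.
by apply/eqP/ffunP=> j; rewrite ffunE; apply/eqP/negPn/u0.
Qed.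

Lemma max_word_ge j : u j <= max_word u.
Proof. exact: leq_bigmax. Qed.

Lemma min_word_le j : u j != 0 -> min_word u <= u j.
Proof. by move=> uj; apply: bigminn_le. Qed.

Lemma min_word_attained : exists2 j, u j != 0 & u j = min_word u.
Proof.
rewrite /min_word.
case: (bigminn_attained (fun j => u j != 0) u (max_word u)) => [->|[j uj ->]];
  last by exists j.
have [j uj] := exists_letter.
have : 0 < #|'I_n| by apply/card_gt0P; exists j.
case/(eq_bigmax u) => i max_i; exists i; rewrite /max_word ?max_i //.
by rewrite -lt0n -max_i; apply: leq_trans (max_word_ge j); rewrite lt0n.
Qed.

(** If [level u r] has as many elements as A, then it contains all particles of
    u, so r is at most the least letter. *)
Lemma switch_levelE : switch_level A u = min_word u.
Proof.
apply/maxn_idPl; rewrite big_seq_cond; apply/bigmax_leqP_seq => r _.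
rewrite mem_index_iota => /andP[/andP[le_ar _] le_A].
have [j uj def_a] := min_word_attained.
have a0 : 0 < min_word u by rewrite -def_a lt0n.
have: level u r == level u (min_word u).
  by rewrite eqEcard level_sub //= (leq_trans (leA_level a0)).
by move/eqP/setP/(_ j); rewrite !inE def_a leqnn.
Qed.

(** The sets of paired particles grow as the level decreases, so being unpaired
    at level r + 1 means being unpaired at all higher levels. *)
Lemma newly_pairedE r : 0 < r -> newly_paired A u r = layer A u r.
Proof.
move=> r0; apply/setP=> j; rewrite [in LHS]inE in_setD andbC; congr (_ && _).
apply/allP/idP => [all_r | jr r'].
  have [lt_rK | le_Kr] := ltnP r (max_word u).
    by apply: all_r; rewrite mem_index_iota leqnn.
  by rewrite (level_gt max_word_ge) // paired_low0 inE.
rewrite mem_index_iota => /andP[lt_rr' _]; apply: contra jr.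
apply/subsetP/paired_lowS; last exact: leA_level.
exact: level_sub.
Qed.

(** Ferrari-Martin runs through all labels from k down to r + 1, the pairing
    phase only through those between the least and the greatest letter of u;
    the layers outside this range are empty. *)
Lemma row_op_fm_step_neq0 k r : 0 < r -> (forall j, u j != 0 -> r < u j <= k) ->
  row_op r A u = fm_step k r A u.
Proof.
move=> r0 ur; have uk j : u j <= k by case: (eqVneq (u j) 0) => [->//|/ur/andP[]].
have [j0 uj0 def_a] := min_word_attained.
have lt_ra : r < min_word u by rewrite -def_a; case/andP: (ur _ uj0).
have a0 : 0 < min_word u by apply: leq_trans lt_ra.
have le_aK : min_word u <= max_word u by rewrite -def_a max_word_ge.
have le_Kk : max_word u <= k by apply/bigmax_leqP=> j _.
rewrite /row_op (negPf u_neq0) /collapsing_phase switch_levelE downto_rcons //.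
rewrite downto_nil //= /newly_unpaired unpaired_up0 ?leA_level // set0D assign0.
rewrite /fm_step; have [||-> ->] := @fm_foldE k r.+1 => //.
  by rewrite /= ltnS; apply: leq_trans le_Kk; apply: leq_trans le_aK; apply: ltnW.
rewrite /pairing_phase switch_levelE; congr assign; last first.
  rewrite (level_low min_word_le (r := r.+1)) //.
  by apply/setP=> j; rewrite !inE; case: (j \in A); rewrite //= ?andbF ?andbT ?negbK.
rewrite /layer_word (@downto_cat k (max_word u) r.+1) //; last by apply: leq_trans le_aK; lia.
rewrite (@downto_cat (max_word u) (min_word u).-1 r.+1) ?prednK //; last 1 first.
  by lia.
rewrite !foldl_cat [in RHS](foldl_assign0 (S := layer A u) (w0 n)); last first.
  move=> x; rewrite mem_downto => /andP[lt_Kx _].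
  by rewrite /layer (level_gt max_word_ge) // paired_low0 set0D.
rewrite [RHS]foldl_assign0; last first.
  move=> x; rewrite mem_downto => /andP[lt_rx le_xa].
  rewrite /layer (level_low min_word_le (r := x)) 1?(level_low min_word_le (r := x.+1)) ?setDv //.
    by rewrite -ltnS prednK in le_xa.
  by rewrite (leq_trans _ lt_rx) // (leq_trans le_xa) ?leq_pred.
apply: eq_foldl_in => y x; rewrite mem_downto => /andP[le_ax _].
by rewrite newly_pairedE // (leq_trans a0).
Qed.

End Straight.

Lemma row_op_fm_step k r A u : 0 < r -> r <= k -> (forall j, u j != 0 -> r < u j <= k) ->
  #|level u 1| <= #|A| -> row_op r A u = fm_step k r A u.
Proof.
move=> r0 le_rk ur leA; have [u0|u_neq0] := eqVneq u (w0 n); last first.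
  exact: row_op_fm_step_neq0.
have lev0 x : 0 < x -> level u x = set0.
  by move=> x0; apply: level_gt x0 => j; rewrite u0 ffunE.
rewrite /row_op u0 eqxx -u0 /fm_step.
have [||-> ->] := @fm_foldE A u leA k r.+1 => //; first by move=> j; rewrite u0 ffunE.
rewrite lev0 // paired_low0 setD0 /layer_word foldl_assign0 ?u0 // => x.
rewrite mem_downto => /andP[lt_rx _].
by rewrite /layer -u0 lev0 ?paired_low0 ?set0D // (leq_trans _ lt_rx).
Qed.

Lemma fm_step_letters k r A u j : 0 < r -> r <= k ->
  if j \in A then r <= fm_step k r A u j <= k else fm_step k r A u j == 0.
Proof.
move=> r0 le_rk; rewrite /fm_step ffunE inE.
set y := foldl _ _ _.
have: if j \in A then (y j == 0) || (r < y j <= k) else y j == 0.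
  have: {subset downto k r.+1 <= [pred l | r < l <= k]} by move=> l; rewrite mem_downto.
  rewrite {}/y; elim/last_ind: (downto k r.+1) => [|s l IHs] sub /=.
    by rewrite ffunE eqxx if_same.
  rewrite foldl_rcons ffunE.
  have sub_s : {subset s <= [pred l | r < l <= k]}.
    by move=> x xs; apply: sub; rewrite mem_rcons inE xs orbT.
  case: (boolP (j \in paired_low _ _)) => [jp|_]; last exact: IHs sub_s.
  move: (subsetP (paired_low_sub _ _) _ jp).
  rewrite inE => /andP[-> _].
  have : l \in [pred l | r < l <= k] by apply: sub; rewrite mem_rcons mem_head.
  by move=> /= lk; rewrite [r < l <= k]lk orbT.
case: ifP => [jA|_] //=; case: eqVneq => [_ _|_ /andP[/ltnW-> ->]] //.
by rewrite leqnn.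
Qed.

End Rows.

(** * Induction on the rows *)

Section Queue.
Variables (n k : nat) (alpha : k.-tuple nat) (Qs : k.-tuple {set 'I_n}).
Hypothesis hQ : is_fmlq alpha Qs.
Hypothesis hstraight : is_partition alpha.

Lemma card_mlq_row_le j : 0 < j -> #|mlq_row Qs j.+1| <= #|mlq_row Qs j|.
Proof.
move=> j0; rewrite /mlq_row /=; have [lt_jk | le_kj] := ltnP j k; last first.
  by rewrite [nth _ _ j]nth_default ?size_tuple // cards0.
have lt_pj : j.-1 < k by rewrite (leq_ltn_trans (leq_pred j)).
have row i (lt_ik : i < k) : #|nth set0 Qs i| = nth 0 alpha i.
  by rewrite -(tnth_nth set0 Qs (Ordinal lt_ik)) hQ (tnth_nth 0).
rewrite !row //; have := sortedP 0 hstraight.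
move/(_ j.-1); rewrite size_tuple prednK //; exact.
Qed.

(** The labels of row j are positive exactly on its particles and lie between
    j and k. This is what the comparison of the next row down needs: labels
    above its number, and no more labelled particles than it has spots. The
    induction starts from the fictitious empty row k + 1. *)
Lemma labels_eq j : 0 < j -> j <= k.+1 ->
  pairing_labels Qs j = fm_labels Qs j /\
  (forall i, if i \in mlq_row Qs j then j <= fm_labels Qs j i <= k
             else fm_labels Qs j i == 0).
Proof.
move=> j0 le_jk; have [d def_j] : exists d, j + d = k.+1 by exists (k.+1 - j); rewrite subnKC.
elim: d j def_j j0 {le_jk} => [|d IHd] j def_j j0.
  rewrite addn0 in def_j; rewrite /pairing_labels /fm_labels /index_iota def_j subnn.
  by split=> // i; rewrite /mlq_row /= nth_default ?size_tuple // inE ffunE.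
have [||IH1 IH2] := IHd j.+1; rewrite ?addSnnS //.
have le_jk : j <= k by lia.
have step (f : nat -> word n -> word n) :
    foldr f (w0 n) (index_iota j k.+1) = f j (foldr f (w0 n) (index_iota j.+1 k.+1)).
  by rewrite /index_iota subSn.
rewrite /pairing_labels /fm_labels !step -/(pairing_labels Qs j.+1) -/(fm_labels Qs j.+1).
split=> [|i]; last exact: fm_step_letters.
rewrite IH1; apply: row_op_fm_step => // [i ui|].
  by have := IH2 i; rewrite (negPf ui); case: ifP.
apply: leq_trans (card_mlq_row_le j0); apply/subset_leq_card/subsetP=> i.
by rewrite inE lt0n => ui; have := IH2 i; rewrite (negPf ui); case: ifP.
Qed.

End Queue.

Theorem lemma3p4 (n k : nat) (hn : 0 < n) (alpha : k.-tuple nat)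
    (Qs : k.-tuple {set 'I_n}) (hQ : is_fmlq alpha Qs)
    (hstraight : is_partition alpha) :
  (forall j : nat, 1 <= j <= k ->
     forall i : 'I_n, pairing_labels Qs j i = fm_labels Qs j i) /\
  Phi Qs = Phi_FM Qs.
Proof.
split=> [j /andP[j0 le_jk] i|]; last by have [] := labels_eq hQ hstraight (j := 1).
by have [->] := labels_eq hQ hstraight j0 (leqW le_jk).
Qed.
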